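(* Let $\alpha\in(0,1)$ and let $(\kappa_d)$ be such that $\{\infty,\kappa_d\}\in\mathbb{T}_\alpha$. Then, for every $\boldsymbol{\vartheta}=\{\boldsymbol{\theta}_d:d\in\mathbb{N}\}\in\boldsymbol{\Theta}$ with $\boldsymbol{\theta}_d=(\theta_{1,d},\dots,\theta_{d,d})$, $$\boldsymbol{\vartheta}\in\mathscr{C}(\{\infty,\kappa_d\})\ \Longleftrightarrow\ \sum_{i=1}^d\frac{\overline{\Phi}(\mathfrak{c}_d-|\theta_{i,d}|)}{\Phi(\mathfrak{c}_d-|\theta_{i,d}|)}\to\infty\ \Longleftrightarrow\ \sum_{i=1}^d g_\infty(\mathfrak{c}_d-|\theta_{i,d}|)\to\infty,$$ where $\mathfrak{c}_d:=\sqrt{2\log(d)}-\frac{\log\log(d)}{2\sqrt{2\log(d)}}$ for $d\ge 2$ (and $\mathfrak{c}_1:=0$).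
   Context: Let $\varepsilon_1,\varepsilon_2,\dots$ be i.i.d. standard normal random variables and $\boldsymbol{\varepsilon}_d = (\varepsilon_1,\dots,\varepsilon_d)$. $\Phi$ is the standard normal cdf and $\overline{\Phi}:=1-\Phi$. The function $g_\infty:\mathbb{R}\to(0,\infty)$ is defined by $g_\infty(x):=w(x)$ if $x<1$ and $g_\infty(x):=e^{-x^2/2}/x$ if $x\ge1$, where $w:\mathbb{R}\to(0,\infty)$ is a fixed (arbitrary) continuous function satisfying $w(z)\to\infty$ as $z\to-\infty$. A (sequence of) test(s) is a sequence $\varphi_d$, $d\in\mathbb{N}$, of Borel measurable functions $\varphi_d:\mathbb{R}^d \to [0,1]$; it has asymptotic size $\alpha\in[0,1]$ if $\lim_{d\to\infty}\mathbb{E}(\varphi_d(\boldsymbol{\varepsilon}_d)) = \alpha$, and $\mathbb{T}_\alpha$ denotes the set of all sequences of tests with asymptotic size $\alpha$. Let $\boldsymbol{\Theta} := \prod_{d=1}^\infty \mathbb{R}^d$ be the set of all triangular arrays $\boldsymbol{\vartheta} = \{\boldsymbol{\theta}_d: d\in\mathbb{N}\}$, $\boldsymbol{\theta}_d\in\mathbb{R}^d$. The consistency set $\mathscr{C}(\varphi_d)\subseteq\boldsymbol{\Theta}$ of a sequence of tests $\varphi_d$ is the set of all $\boldsymbol{\vartheta}\in\boldsymbol{\Theta}$ with $\lim_{d\to\infty}\mathbb{E}(\varphi_d(\boldsymbol{\theta}_d+\boldsymbol{\varepsilon}_d)) = 1$. For $\boldsymbol{x}\in\mathbb{R}^d$,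 $\|\boldsymbol{x}\|_\infty := \max_{i}|x_i|$. For a sequence of real critical values $\kappa_d$, $\{\infty,\kappa_d\}$ denotes the sequence of tests $\mathbf{1}\{\|\cdot\|_\infty \ge \kappa_d\}$. *)

(* Defs.v *)
From HB Require Import structures.
From mathcomp Require Import all_boot all_order all_algebra.
From mathcomp Require Import finmap.
From mathcomp Require Import all_classical all_reals all_analysis.

Set Implicit Arguments.
Unset Strict Implicit.
Unset Printing Implicit Defensive.

Import Order.TTheory GRing.Theory Num.Theory.
Import numFieldNormedType.Exports.

Local Open Scope classical_set_scope.
Local Open Scope ring_scope.

Section GaussianNoise.
Context {disp : measure_display} {Omega : measurableType disp} {R : realType}.
Variable P : probability Omega R.

Definition mutually_independent (I : choiceType) (X : I -> {RV P >-> R}) : Prop :=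
  forall (J : {fset I}) (A : I -> set R), (forall i, measurable (A i)) ->
    P (\bigcap_(i in [set` J]) (X i @^-1` A i)) =
    (\prod_(i <- J) P (X i @^-1` A i))%E.

(* The laws are compared on Borel sets only: measures are total functions on
   [set R], unspecified outside the sigma-algebra. *)
Definition standard_normal (X : {RV P >-> R}) : Prop :=
  forall A : set R, measurable A -> distribution P X A = normal_prob 0 1 A.

Definition iid_standard_normal (eps : nat -> {RV P >-> R}) : Prop :=
  mutually_independent eps /\ forall i, standard_normal (eps i).

End GaussianNoise.

Section Functions.
Context {R : realType}.
Implicit Types x : R.

Definition Phi x : R := fine (normal_prob (0 : R) 1 `]-oo, x]).

Definition Phibar x : R := 1 - Phi x.

Definition g_infty (w : R -> R) x : R :=
  if x < 1 then w x else expR (- (x ^+ 2 / 2)) / x.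

Definition frak_c (d : nat) : R :=
  if (2 <= d)%N then
    Num.sqrt (2 * ln d%:R) - ln (ln d%:R) / (2 * Num.sqrt (2 * ln d%:R))
  else 0.

End Functions.

(* Vectors of R^d are d.-tuples, whose measurable sets are those of the product
   sigma-algebra, i.e. the Borel sets of R^d. Sequences indexed by d also carry
   a component at d = 0 (where R^0 is a point); it plays no role in the limits. *)

Definition vadd {R : realType} {d : nat} (x y : d.-tuple R) : d.-tuple R :=
  [tuple tnth x i + tnth y i | i < d].

Definition supnorm {R : realType} {d : nat} (x : d.-tuple R) : R :=
  \big[Num.max/0]_(i < d) `|tnth x i|.

Definition triangular_array (R : realType) : Type := forall d : nat, d.-tuple R.

Definition is_test {R : realType} (phi : forall d : nat, d.-tuple R -> R) : Prop :=
  forall d, measurable_fun [set: d.-tuple R] (phi d) /\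
            forall x, 0 <= phi d x <= 1.

Definition sup_test {R : realType} (kappa : nat -> R) (d : nat) :
    d.-tuple R -> R :=
  \1_[set x : d.-tuple R | kappa d <= supnorm x].

Section Tests.
Context {disp : measure_display} {Omega : measurableType disp} {R : realType}.
Variables (P : probability Omega R) (eps : nat -> {RV P >-> R}).

(* [eps] is indexed from 0. *)
Definition noise (d : nat) (omega : Omega) : d.-tuple R :=
  [tuple eps i omega | i < d].

Definition tests_of_asymptotic_size (alpha : R) :
    set (forall d : nat, d.-tuple R -> R) :=
  [set phi | is_test phi /\
    'E_P[fun omega => phi d (noise d omega)]%E @[d --> \oo] --> alpha%:E].

Definition consistency_set (phi : forall d : nat, d.-tuple R -> R) :
    set (triangular_array R) :=
  [set theta |
    'E_P[fun omega => phi d (vadd (theta d) (noise d omega))]%E @[d --> \oo]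
      --> 1%E].

End Tests.

(* Main.v *)
(* Write [odds x = Phibar x / Phi x], so that [Phi x = (1 + odds x)^-1]. The
   test accepts with probability the product of the [coverage kappa |theta_i|],
   where [coverage k t = Phi (k - t) - Phi (- k - t)]. Log-concavity of [Phi]
   yields [Phi (k - t) * coverage k 0 <= coverage k t <= Phi (k - t)] for
   [t >= 0]; hence, with [S] the sum of the [odds (kappa - |theta_i|)], the
   acceptance probability lies between [exp (- S)] times the one under the null
   hypothesis, which tends to [1 - alpha > 0], and [1 / (1 + S)]. Consistency
   thus means [S -> +oo].

   Both [d * Phibar (kappa d)] (by the asymptotic size) and
   [d * Phibar (frak_c d)] (by Mills' ratio) stay between positive constants.
   Log-concavity propagates this comparison to all shifts [t <= kappa + frak_c]
   at once, whereas for larger [t] a single summand is already of order [d];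
   so [kappa] may be replaced by [frak_c]. The comparison with [g_infty] is
   termwise, by Mills' ratio on [[1, +oo[, compactness on bounded intervals,
   and because both functions blow up at [-oo]. *)

Require Import Defs.
From HB Require Import structures.
From mathcomp Require Import all_boot all_order all_algebra.
From mathcomp Require Import finmap ring lra.
From mathcomp Require Import all_classical all_reals all_analysis.
From mathcomp Require Import measurable_realfun.

Import Order.TTheory GRing.Theory Num.Theory.
Import numFieldNormedType.Exports.

Local Open Scope classical_set_scope.
Local Open Scope ring_scope.

(** * Calculus of the normal law: symmetry, Mills' ratio, log-concavity of [Phi] *)

Lemma is_derive_le0_le {R : realType} {f : R -> R} (df : R -> R) {a b : R} :
  a <= b -> (forall x, a <= x <= b -> is_derive x 1 f (df x)) ->
  (forall x, a <= x <= b -> df x <= 0) -> f b <= f a.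
Proof.
move=> ab fdf df0.
have cf : {within `[a, b], continuous f}.
  by apply: derivable_within_continuous => x; rewrite in_itv/= => /fdf[].
have [x|c cab] := @MVT_segment R f df a b ab _ cf.
  by rewrite in_itv/= => /andP[/ltW ? /ltW ?]; apply: fdf; apply/andP.
move: cab; rewrite in_itv/= => cab /eqP; rewrite subr_eq => /eqP ->.
by rewrite gerDr mulr_le0_ge0 ?subr_ge0// df0.
Qed.

Section Gaussian.
Context {R : realType}.
Implicit Types x y a b : R.

Local Notation phi := (normal_pdf (0 : R) 1).

Lemma phiE x : phi x = normal_peak 1 * expR (- (x ^+ 2 / 2)).
Proof.
by rewrite normal_pdfE// /normal_fun subr0 expr1n mulNr.
Qed.

Lemma phi_gt0 x : 0 < phi x.
Proof. by rewrite phiE mulr_gt0 ?normal_peak_gt0 ?expR_gt0. Qed.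

Lemma phiN x : phi (- x) = phi x.
Proof. by rewrite !phiE sqrrN. Qed.

Lemma is_derive_phi x : is_derive x 1 phi (- x * phi x).
Proof.
have -> : phi = (fun y => normal_peak 1 * expR (- (y ^+ 2 / 2))).
  by apply/funext => y; rewrite phiE.
apply: is_derive_eq.
by rewrite /GRing.scale/= !(mulr0, add0r, mulr1); field.
Qed.

Lemma Phi_ge0 x : 0 <= Phi x.
Proof. by rewrite fine_ge0. Qed.

Lemma Phi_le1 x : Phi x <= 1.
Proof.
rewrite -lee_fin fineK ?fin_num_measure//; exact: probability_le1.
Qed.

(** As a random variable under the normal law, the identity has distribution function [Phi]; the
    general limits of distribution functions thus apply to [Phi]. *)
Let idTR : measurableTypeR R -> R := idfun.

#[local] HB.instance Definition _ :=
  @isMeasurableFun.Build _ _ _ _ idTR (@measurable_id _ _ setT).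

Lemma Phi_inf e : 0 < e -> exists x, Phi x < e.
Proof.
move=> e0; have := cvg_cdfNy0 (idTR : {RV (normal_prob (0 : R) 1) >-> R}).
move/fine_cvgP => [_] /cvgr_lt/(_ _ e0) [M [_ MP]].
by exists (M - 1); apply: MP; rewrite ltrBlDr ltrDl.
Qed.

Lemma Phi_sup e : 0 < e -> exists x, 1 - e < Phi x.
Proof.
move=> e0; have := cvg_cdfy1 (idTR : {RV (normal_prob (0 : R) 1) >-> R}).
have e1 : 1 - e < 1 by rewrite ltrBlDr ltrDl.
move/fine_cvgP => [_] /cvgr_gt/(_ _ e1) [M [_ MP]].
by exists (M + 1); apply: MP; rewrite ltrDl.
Qed.

Lemma is_derive_Phi x : is_derive x 1 Phi (phi x).
Proof.
have [//| | | |d <-] := @continuous_FTC1 R phi -oo%O x (x + 1).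
- by rewrite ltrDl.
- exact: (integrableS _ _ (subsetT _) (integrable_normal_pdf 0 1)).
- by rewrite ltNyr.
- exact: continuous_normal_pdf.
by rewrite derive1E; exact: DeriveDef.
Qed.

Lemma Phi_MVT a b : a < b ->
  exists2 c, a < c < b & Phi b - Phi a = phi c * (b - a).
Proof.
move=> ab; have [||c cab ->] := @MVT R Phi phi a b ab.
- by move=> x _; exact: is_derive_Phi.
- by apply: derivable_within_continuous => x _; have [] := is_derive_Phi x.
by exists c; first by move: cab; rewrite in_itv.
Qed.

Lemma ltr_Phi : {mono @Phi R : x y / x < y}.
Proof.
apply: leW_mono; apply: le_mono => x y xy; rewrite -subr_gt0.
by have [c _ ->] := Phi_MVT _ _ xy; rewrite mulr_gt0 ?phi_gt0 ?subr_gt0.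
Qed.

Lemma ler_Phi : {mono @Phi R : x y / x <= y}.
Proof. by move=> x y; rewrite !leNgt ltr_Phi. Qed.

Lemma Phi_gt0 x : 0 < Phi x.
Proof.
by apply: (le_lt_trans (Phi_ge0 (x - 1))); rewrite ltr_Phi gtrDl ltrN10.
Qed.

(** The density is even, so [Phi y + Phi (- y)] is constant; far-left points bound the constant
    above by [1], far-right ones below. *)
Lemma PhiN x : Phi (- x) = 1 - Phi x.
Proof.
pose D y := Phi y + Phi (- y).
have Dcst y : D y = D 0.
  apply: is_derive_0_is_cst => z.
  have ? := is_derive_Phi z.
  have dN : is_derive z 1 (fun t => Phi (- t)) (- phi z).
    have ? : is_derive (- z) 1 Phi (phi z) by rewrite -phiN; exact: is_derive_Phi.
    apply: is_derive_eq.
    by rewrite mulrN1.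
  by rewrite /D; apply: is_derive_eq; rewrite subrr.
have : D 0 = 1.
  apply/eqP; rewrite eq_le; apply/andP; split; apply/ler_addgt0Pr => e e0.
    have [y ye] := Phi_inf e e0.
    by rewrite -(Dcst y) addrC lerD ?Phi_le1// ltW.
  have [y ye] := Phi_sup e e0.
  by rewrite -lerBlDr -(Dcst y) (le_trans (ltW ye))// lerDl Phi_ge0.
by rewrite -(Dcst x) => <-; rewrite /D addrAC subrr add0r.
Qed.

Lemma PhibarE x : Phibar x = Phi (- x).
Proof. by rewrite PhiN. Qed.

(* [phi x / x - Phi (- x)] has derivative [- phi x / x ^+ 2] and tends to [0]
   at [+oo]. *)
Lemma mills_ub x : 0 < x -> Phi (- x) <= phi x / x.
Proof.
move=> x0; rewrite -subr_ge0; apply/ler_addgt0Pr => e e0.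
have [z ze] := Phi_inf e e0.
(* [y] lies beyond [x] and has tail at most [e], whence [f x >= f y >= - e]. *)
pose y := Num.max x (- z).
have xy : x <= y by rewrite le_max lexx.
have yz : Phi (- y) <= e.
  by rewrite (le_trans _ (ltW ze))// ler_Phi lerNl le_max lexx orbT.
pose f t := phi t / t - Phi (- t).
have : f y <= f x.
  apply: (@is_derive_le0_le _ f (fun t => - (phi t / t ^+ 2)) x y xy).
    move=> t /andP[xt ty].
    have t0 : 0 < t := lt_le_trans x0 xt.
    have tn0 : t != 0 by rewrite gt_eqF.
    have ? := is_derive_phi t.
    have ? : is_derive (- t) 1 Phi (phi t) by rewrite -phiN; exact: is_derive_Phi.
    have ? : is_derive t 1 (fun u : R => u^-1) (- t ^- 2 *: 1).
      exact: (@is_deriveV _ id).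
    rewrite /f; apply: is_derive_eq.
    rewrite /GRing.scale/=.
    by field.
  move=> t /andP[xt ty].
  by rewrite oppr_le0 divr_ge0 ?sqr_ge0// ltW ?phi_gt0.
rewrite -/(f x) => fyx.
have : - Phi (- y) <= f y.
  by rewrite /f lerDr divr_ge0 ?ltW ?phi_gt0// (lt_le_trans x0).
lra.
Qed.

(** For [x < 0] this is Mills' upper bound at [- x]. It gives the sign of the derivative of
    [phi / Phi]. *)
Lemma Phi_phi_ge0 x : 0 <= x * Phi x + phi x.
Proof.
have [x0|x0] := leP 0 x.
  by rewrite addr_ge0 ?mulr_ge0 ?Phi_ge0// ltW// phi_gt0.
have := mills_ub (- x); rewrite oppr_gt0 opprK phiN => /(_ x0).
by rewrite ler_pdivlMr ?oppr_gt0// mulrN mulrC lerNl -subr_ge0 opprK addrC.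
Qed.

(** Differential form of log-concavity: [phi / Phi] is the derivative of [ln Phi]. *)
Lemma phi_Phi_ratio a b : a <= b -> phi b / Phi b <= phi a / Phi a.
Proof.
move=> ab.
apply: (@is_derive_le0_le _ (fun t => phi t / Phi t)
  (fun t => - (t * Phi t + phi t) * phi t / Phi t ^+ 2) a b ab) => t _.
  have Pn0 : Phi t != 0 by rewrite gt_eqF ?Phi_gt0.
  have ? := is_derive_phi t.
  have ? := is_derive_Phi t.
  have ? := is_deriveV Pn0 (is_derive_Phi t).
  apply: is_derive_eq.
  rewrite /GRing.scale/=.
  by field.
rewrite !mulNr oppr_le0 divr_ge0 ?sqr_ge0 ?mulr_ge0 ?Phi_phi_ge0//.
by rewrite ltW ?phi_gt0.
Qed.

Lemma Phi_logconcave a b e : a <= b -> 0 <= e ->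
  Phi (b + e) / Phi b <= Phi (a + e) / Phi a.
Proof.
move=> ab e0.
apply: (@is_derive_le0_le _ (fun t => Phi (t + e) / Phi t)
  (fun t => (phi (t + e) * Phi t - Phi (t + e) * phi t) / Phi t ^+ 2) a b ab) => t _.
  have Pn0 : Phi t != 0 by rewrite gt_eqF ?Phi_gt0.
  have ? := is_derive_Phi t.
  have ? := is_deriveV Pn0 (is_derive_Phi t).
  have ? := is_derive_Phi (t + e).
  have ? : is_derive t 1 (fun t => Phi (t + e)) (phi (t + e)).
    by apply: is_derive_eq; rewrite addr0 /GRing.scale/= mulr1.
  apply: is_derive_eq.
  rewrite /GRing.scale/=.
  by field.
rewrite mulr_le0_ge0 ?invr_ge0 ?sqr_ge0// subr_le0.
rewrite [leRHS]mulrC -ler_pdivrMr ?Phi_gt0// mulrAC -ler_pdivlMr ?Phi_gt0//.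
by rewrite phi_Phi_ratio// lerDl.
Qed.

(* Mean value theorem on [[- (x + x^-1), - x]]. *)
Lemma mills_lb x : 1 <= x -> expR (- (3 / 2)) * (phi x / x) <= Phi (- x).
Proof.
move=> x1; have x0 : 0 < x by rewrite (lt_le_trans _ x1).
have [|c /andP[c1 c2]] := Phi_MVT (- (x + x^-1)) (- x).
  by rewrite ltrN2 ltrDl invr_gt0.
rewrite opprK addKr => PE.
have : phi c / x <= Phi (- x) by rewrite -PE lerBlDr lerDl Phi_ge0.
apply: le_trans.
rewrite mulrA ler_pM2r ?invr_gt0// !phiE mulrCA ler_pM2l ?normal_peak_gt0//.
rewrite -expRD ler_expR.
have xi1 : x^-1 <= 1 by rewrite invf_le1.
have xi0 : 0 < x^-1 by rewrite invr_gt0.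
have xxi : x * x^-1 = 1 by rewrite mulfV ?gt_eqF.
(* The factor [expR (- (3 / 2))] comes from [(x + x^-1) ^+ 2 <= x ^+ 2 + 3]. *)
have : c ^+ 2 <= (x + x^-1) ^+ 2.
  by rewrite -sqrrN ler_sqr ?nnegrE; lra.
rewrite sqrrD xxi.
have : x^-1 ^+ 2 <= 1 by rewrite expr_le1// ltW.
lra.
Qed.

End Gaussian.

(** * Acceptance probability of one coordinate *)

Section Coverage.
Context {R : realType}.
Implicit Types k t x y : R.

Definition coverage k t : R := Phi (k - t) - Phi (- k - t).

Lemma coverageN k t : coverage k (- t) = coverage k t.
Proof.
rewrite /coverage opprK.
have -> : - k + t = - (k - t) by ring.
have -> : - k - t = - (k + t) by ring.
by rewrite !PhiN; ring.
Qed.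

Lemma coverage_norm k t : coverage k `|t| = coverage k t.
Proof. by case: (ger0P t) => // _; rewrite coverageN. Qed.

(** The test rejects at equality, hence the open interval; its right endpoint may be added because
    the law has a density. *)
Lemma normal_prob_itv_oo k t : 0 <= k ->
  normal_prob 0 1 `](- k - t), (k - t)[%classic = (coverage k t)%:E.
Proof.
move=> k0.
rewrite /normal_prob integral_itv_bndo_bndc; last first.
  apply: measurable_funTS; apply/measurable_EFinP.
  exact: measurable_normal_pdf.
rewrite -/(normal_prob 0 1 _).
have -> : `](- k - t), (k - t)]%classic = `]-oo, (k - t)] `\` `]-oo, (- k - t)] :> set R.
  apply/seteqP; split => x /=; rewrite !in_itv/= ltNge.
    by move=> /andP[/negP ? ?].
  by move=> [? /negP ->].
rewrite measureD//= ?ltey_eq ?fin_num_measure//.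
rewrite (_ : _ `&` _ = `]-oo, (- k - t)]%classic); last first.
  apply/setIidPr => x /=; rewrite !in_itv/= => /le_trans; apply; lra.
by rewrite /coverage EFinB !fineK ?fin_num_measure.
Qed.

End Coverage.

(** * Rejection probability of the sup-norm test *)

Section SupTest.
Context {disp : measure_display} {Omega : measurableType disp} {R : realType}.
Variables (P : probability Omega R) (eps : nat -> {RV P >-> R}).
Hypothesis eps_iid : iid_standard_normal eps.

Lemma expectation_sup_test (d : nat) (kappa : nat -> R) (theta : d.-tuple R) :
  0 < kappa d ->
  'E_P[fun omega => sup_test kappa (vadd theta (noise eps d omega))]%E =
  (1 - \prod_(i < d) coverage (kappa d) `|tnth theta i|)%:E.
Proof.
move=> k0; case: eps_iid => eps_ind eps_norm.
(* [nth 0] extends [theta] to all of [nat], the index type of the independent family. *)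
pose I i : set R := `](- kappa d - nth 0 theta i), (kappa d - nth 0 theta i)[%classic.
pose J := seq_fset tt (iota 0 d).
pose B := \bigcap_(i in [set` J]) (eps i @^-1` I i).
have mB : measurable B.
  apply: fin_bigcap_measurable => [|i _]; first exact: finite_fset.
  by apply: measurable_funPTI; exact: measurable_itv.
have PB : P B = (\prod_(i < d) coverage (kappa d) `|tnth theta i|)%:E.
  rewrite /B eps_ind; last by move=> i; exact: measurable_itv.
  rewrite (perm_big (iota 0 d))/=; last first.
    by have := seq_fset_perm tt (iota 0 d); rewrite undup_id ?iota_uniq.
  rewrite -[d in iota 0 d]subn0 -/(index_iota 0 d) big_mkord -prodEFin.
  apply: eq_bigr => i _; rewrite coverage_norm (tnth_nth 0).
  by rewrite -normal_prob_itv_oo ?ltW// -(eps_norm i)//; exact: measurable_itv.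
have -> : (fun omega => sup_test kappa (vadd theta (noise eps d omega))) = \1_(~` B).
  apply/funext => omega; rewrite /sup_test !indicE; congr (nat_of_bool _)%:R.
  rewrite in_setC; apply/idP/idP => [|/negP oB]; rewrite inE/=.
    rewrite leNgt => /negP supk; apply/negP; rewrite inE => oB; apply: supk.
    (* [0 < kappa d] serves here: the maximum in [supnorm] starts from [0]. *)
    apply: bigmax_lt => // i _.
    have /oB : [set` J] (i : nat) by rewrite /= seq_fsetE mem_iota ltn_ord.
    rewrite /I /= in_itv/= /vadd /noise !tnth_mktuple (tnth_nth 0) => /andP[? ?].
    by rewrite ltr_norml; apply/andP; split; lra.
  rewrite leNgt; apply/negP => /bigmax_ltP[_ supk]; apply: oB; rewrite inE => i /=.
  rewrite seq_fsetE mem_iota add0n => /andP[_ id].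
  have := supk (Ordinal id) isT.
  rewrite /I /= in_itv/= /vadd /noise !tnth_mktuple (tnth_nth 0)/= ltr_norml => /andP[? ?].
  by apply/andP; split; lra.
by rewrite expectation_indic ?probability_setC ?PB//; exact: measurableC.
Qed.

End SupTest.

(** * Odds: product bounds and change of critical value *)

Section Odds.
Context {R : realType}.
Implicit Types k c t x y : R.

Definition odds x : R := Phibar x / Phi x.

Lemma oddsE x : odds x = (Phi x)^-1 - 1.
Proof. by rewrite /odds /Phibar mulrBl mul1r mulfV// gt_eqF ?Phi_gt0. Qed.

Lemma Phi_odds x : Phi x = (1 + odds x)^-1.
Proof. by rewrite oddsE addrC subrK invrK. Qed.

Lemma odds_gt0 x : 0 < odds x.
Proof. by rewrite /odds PhibarE divr_gt0 ?Phi_gt0. Qed.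

Lemma odds_le x y : x <= y -> odds y <= odds x.
Proof. by move=> xy; rewrite !oddsE lerD2r lef_pV2 ?posrE ?Phi_gt0// ler_Phi. Qed.

Lemma prod_Phi_le n (x : 'I_n -> R) :
  \prod_(i < n) Phi (x i) <= (1 + \sum_(i < n) odds (x i))^-1.
Proof.
under eq_bigr do rewrite Phi_odds.
rewrite prodfV.
have : 1 <= 1 + \sum_(i < n) odds (x i) <= \prod_(i < n) (1 + odds (x i)).
  elim/big_rec2 : _ => [|i p s _ /andP[s1 sp]]; first by rewrite addr0 lexx.
  have := odds_gt0 (x i) => o0; apply/andP; split; first by lra.
  rewrite mulrDl mul1r addrCA addrC lerD// ler_peMr ?(ltW o0)//; lra.
by move=> /andP[s1 sp]; rewrite lef_pV2 ?posrE//; lra.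
Qed.

Lemma prod_Phi_ge n (x : 'I_n -> R) :
  expR (- \sum_(i < n) odds (x i)) <= \prod_(i < n) Phi (x i).
Proof.
rewrite -sumrN expR_sum; apply: ler_prod => i _; rewrite expR_ge0/= Phi_odds.
rewrite expRN lef_pV2 ?posrE ?expR_gt0 ?expR_ge1Dx//.
by rewrite addr_gt0 ?odds_gt0.
Qed.

Lemma coverage_le k t : coverage k t <= Phi (k - t).
Proof. by rewrite /coverage gerBl Phi_ge0. Qed.

Lemma coverage0 k : coverage k 0 = 1 - 2 * Phi (- k).
Proof. by rewrite /coverage !subr0 PhiN; ring. Qed.

Lemma coverage_gt0 k t : 0 < k -> 0 < coverage k t.
Proof. by move=> k0; rewrite /coverage subr_gt0 ltr_Phi; lra. Qed.

(** Log-concavity over a step [2 * k] gives [Phi (- k - t) / Phi (k - t) <= Phi (- k) / Phi k], so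
    [coverage k t / Phi (k - t)] is at least [coverage k 0 / Phi k]; then [Phi k <= 1]. *)
Lemma coverage_ge k t : 0 < k -> 0 <= t ->
  Phi (k - t) * coverage k 0 <= coverage k t.
Proof.
move=> k0 t0; have Pk := Phi_gt0 k.
have Pmt : - k - t <= - k by lra.
have k20 : 0 <= 2 * k by lra.
have := Phi_logconcave _ _ _ Pmt k20.
have -> : - k + 2 * k = k by ring.
have -> : - k - t + 2 * k = k - t by ring.
rewrite ler_pdivlMr ?Phi_gt0// mulrAC ler_pdivrMr ?Phi_gt0// => H.
apply: (@le_trans _ _ (Phi (k - t) * (coverage k 0 / Phi k))).
  by rewrite ler_pM2l ?Phi_gt0// ler_pdivlMr// ler_piMr ?Phi_le1// ltW ?coverage_gt0.
rewrite mulrA ler_pdivrMr// /coverage !subr0; lra.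
Qed.

(** By log-concavity the growth factor of a positive shift is largest at the leftmost point [- c],
    where it is [Phi (- k) / Phi (- c) <= D]. *)
Lemma Phi_shift (D : R) k c y : 1 <= D -> Phi (- k) <= D * Phi (- c) ->
  - c <= y -> Phi (y + (c - k)) <= D * Phi y.
Proof.
move=> D1 kc cy; have [ck|/ltW kc0] := leP c k.
  apply: (@le_trans _ _ (Phi y)); first by rewrite ler_Phi; lra.
  by rewrite ler_peMl ?Phi_ge0.
have ck0 : 0 <= c - k by rewrite subr_ge0.
have := Phi_logconcave _ _ _ cy ck0; rewrite addKr ler_pdivrMr ?Phi_gt0//.
move/le_trans; apply; rewrite ler_pM2r ?Phi_gt0//.
by rewrite ler_pdivrMr ?Phi_gt0.
Qed.

(* For [t > c + k] the ratio of the two odds is not controlled, but then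
   [c - t < - k], so that [odds (c - t)] is itself large. *)
Lemma odds_shift (D : R) k c t : 1 <= D -> 0 <= t -> Phi (- k) <= D * Phi (- c) ->
  (Phi (- k))^-1 - 1 <= odds (c - t) \/ odds (k - t) <= D ^+ 2 * odds (c - t).
Proof.
move=> D1 t0 kc; have [tck|tck] := leP t (c + k).
  (* Numerator and denominator each cost one factor [D]: [Phi_shift] is applied at [t - c], using
     [0 <= t], and at [k - t], using [t <= c + k]. *)
  right; rewrite /odds !PhibarE expr2 mulrACA ler_pM ?Phi_ge0 ?invr_ge0 ?Phi_ge0//.
    have -> : - (k - t) = - (c - t) + (c - k) by ring.
    by apply: Phi_shift => //; lra.
  rewrite ler_pdivlMr ?Phi_gt0// mulrC ler_pdivrMr ?Phi_gt0//.
  have -> : c - t = k - t + (c - k) by ring.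
  by apply: Phi_shift => //; lra.
left; rewrite oddsE lerD2r lef_pV2 ?posrE ?Phi_gt0// ler_Phi; lra.
Qed.

End Odds.

(** * Divergence of sums by termwise domination *)

Section SumDomination.
Context {R : realType}.

(** To push the sum of [g] above [K], either one summand suffices, or all summands are comparable
    and the sum of [h] exceeds [C * K]. The constant may depend on [K]. *)
Lemma sum_dominated_pinfty (h g : forall d, 'I_d -> R) :
  (forall d i, 0 <= h d i) -> (forall d i, 0 <= g d i) ->
  (forall K, exists2 C, 0 < C &
     \forall d \near \oo, forall i, K <= g d i \/ h d i <= C * g d i) ->
  \sum_(i < d) h d i @[d --> \oo] --> +oo ->
  \sum_(i < d) g d i @[d --> \oo] --> +oo.
Proof.
move=> h0 g0 hg /cvgryPge hy; apply/cvgryPge => K.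
have [C C0 HC] := hg K.
near=> d.
have gh : forall i, K <= g d i \/ h d i <= C * g d i by near: d.
have [[i Ki]|nK] := pselect (exists i, K <= g d i).
  by rewrite (bigD1 i)//= (le_trans Ki)// lerDl sumr_ge0.
have hCg : \sum_(i < d) h d i <= C * \sum_(i < d) g d i.
  rewrite mulr_sumr ler_sum// => i _.
  have [Ki|//] := gh i.
  by exfalso; apply: nK; exists i.
rewrite -(ler_pM2l C0); apply: le_trans hCg.
by near: d; exact: hy.
Unshelve. all: by end_near. Qed.

End SumDomination.

(** * Tail of the normal law at [frak_c] *)

Section Asymptotics.
Context {R : realType}.

Lemma nat_ln_pinfty : ln (d%:R : R) @[d --> \oo] --> +oo.
Proof.
apply/cvgryPge => A.
have [N _ NA] := (cvgryPge _).1 (@cvgr_idn R) (expR A).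
exists N => // d /= Nd; have := NA d Nd => Ad.
by rewrite -ler_expR lnK// posrE (lt_le_trans _ Ad) ?expR_gt0.
Qed.

(** The double-logarithm correction raises [expR (- (c ^+ 2 / 2))] from order [1 / d] to order
    [sqrt (ln d) / d], which the division by [c] compensates. *)
Lemma frak_c_bounds (d : nat) : 2 <= ln (d%:R : R) ->
  let c := frak_c d : R in
  1 <= c /\
  expR (- (1 / 4)) / 2 <= d%:R * (expR (- (c ^+ 2 / 2)) / c) <= 4 / 3.
Proof.
set L := ln _ => L2.
have d0 : 0 < d%:R :> R.
  rewrite ltNge; apply/negP => d0; have := L2; rewrite /L ln0//; lra.
have d2 : (2 <= d)%N.
  rewrite leqNgt; apply/negP => d2; have : d%:R <= 1 :> R by rewrite lern1 -ltnS.
  move=> d1; have := L2; rewrite /L; have := ln_le0 d1; lra.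
rewrite /= /frak_c d2 -/L.
set s := Num.sqrt _; set l := ln L; set c := _ - _.
have s2 : s ^+ 2 = 2 * L by rewrite sqr_sqrtr//; lra.
have s0 : 0 < s by rewrite sqrtr_gt0; lra.
(* [E] is [Num.sqrt L]; since [c ^+ 2 = 2 * L - l + l ^+ 2 / (8 * L)], the
   density at [c] is [d^-1 * E] up to a bounded factor. *)
pose E := expR (l / 2).
have E0 : 0 < E := expR_gt0 _.
have EL : E ^+ 2 = L.
  by rewrite -expRM_natl mulrC divfK// lnK// posrE; lra.
have l0 : 0 <= l by rewrite ln_ge0//; lra.
have lE : 1 + l / 2 <= E := expR_ge1Dx _.
have lL : l <= L.
  by rewrite -[leRHS]lnK ?posrE; [have := expR_ge1Dx l; lra | lra].
have s_ge2 : 2 <= s by rewrite -ler_sqr ?nnegrE; lra.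
have Es : E <= s by rewrite -ler_sqr ?nnegrE; lra.
have ls : 0 <= l / (2 * s) <= s / 4.
  rewrite divr_ge0/=; [|lra|lra].
  rewrite ler_pdivrMr; [|lra].
  have -> : s / 4 * (2 * s) = s ^+ 2 / 2 by field.
  rewrite s2; lra.
have cs : s * (3 / 4) <= c <= s by rewrite /c; lra.
have c0 : 0 < c by lra.
split; first lra.
have c2 : c ^+ 2 = 2 * L - l + l ^+ 2 / (8 * L).
  rewrite /c sqrrB s2.
  have -> : s * (l / (2 * s)) *+ 2 = l by field; rewrite gt_eqF.
  by rewrite expr_div_n exprMn s2; field; rewrite gt_eqF//; lra.
pose r := expR (- (l ^+ 2 / (16 * L))).
have -> : expR (- (c ^+ 2 / 2)) = d%:R^-1 * E * r.
  have -> : d%:R = expR L :> R by rewrite lnK.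
  rewrite -expRN -!expRD c2; congr expR; field; rewrite gt_eqF//; lra.
have r_le1 : r <= 1.
  by rewrite -expR0 ler_expR oppr_le0 divr_ge0 ?sqr_ge0//; lra.
(* [l <= 2 * E] means [l ^+ 2 <= 4 * L], so the exponent is at most [1 / 4] in size. *)
have r_ge : expR (- (1 / 4)) <= r.
  rewrite ler_expR lerN2 ler_pdivrMr; last lra.
  have : l ^+ 2 <= (2 * E) ^+ 2 by rewrite ler_sqr ?nnegrE; lra.
  rewrite exprMn EL; lra.
have -> : d%:R * (d%:R^-1 * E * r / c) = E / c * r.
  by field; rewrite !gt_eqF.
(* Combines [E <= s <= 2 * E] with [s * (3 / 4) <= c <= s]. *)
have Ec : 2^-1 <= E / c <= 4 / 3.
  rewrite ler_pdivlMr// ler_pdivrMr//; apply/andP; split; last by lra.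
  have : s <= 2 * E by rewrite -ler_sqr ?nnegrE ?exprMn; lra.
  lra.
have r0 : 0 < r := expR_gt0 _.
have e0 : 0 < expR (- (1 / 4)) :> R := expR_gt0 _.
apply/andP; split.
  by rewrite mulrC ler_pM; lra.
by rewrite -[leRHS]mulr1 ler_pM; lra.
Qed.

Lemma frak_c_tail : exists2 A : R, 0 < A &
  exists B : R, \forall d \near \oo, A <= d%:R * Phi (- frak_c d) <= B.
Proof.
pose p : R := normal_peak 1.
have p0 : 0 < p by rewrite normal_peak_gt0.
pose e := expR (- (1 / 4)) : R.
exists (expR (- (3 / 2)) * (p * (e / 2))).
  by rewrite !mulr_gt0 ?expR_gt0.
exists (p * (4 / 3)).
near=> d.
have /frak_c_bounds[] : 2 <= ln (d%:R : R).
  by near: d; exact: (cvgryPge _).1 nat_ln_pinfty 2.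
set c := frak_c d => c1 /andP[lb ub].
have c0 : 0 < c by lra.
have d0 : 0 <= d%:R :> R by [].
have phic : normal_pdf 0 1 c / c = p * (expR (- (c ^+ 2 / 2)) / c).
  by rewrite phiE mulrA.
apply/andP; split.
  apply: (@le_trans _ _ (d%:R * (expR (- (3 / 2)) * (normal_pdf 0 1 c / c)))).
    by rewrite [leRHS]mulrCA ler_pM2l ?expR_gt0// phic [leRHS]mulrCA ler_pM2l.
  by rewrite ler_wpM2l// mills_lb.
apply: (@le_trans _ _ (d%:R * (normal_pdf 0 1 c / c))).
  by rewrite ler_wpM2l// mills_ub.
by rewrite phic [leLHS]mulrCA ler_pM2l.
Unshelve. all: by end_near. Qed.

End Asymptotics.

(** * Termwise comparison of [odds] and [g_infty] *)

Section OddsVsG.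
Context {R : realType}.
Variable w : R -> R.
Hypotheses (w_gt0 : forall x, 0 < w x) (w_cont : continuous w).
Implicit Types K x z : R.

Lemma g_infty_gt0 x : 0 < g_infty w x.
Proof.
rewrite /g_infty; case: (ltP x 1) => x1; first exact: w_gt0.
by rewrite divr_gt0 ?expR_gt0// (lt_le_trans _ x1).
Qed.

Lemma odds_large K : exists z, forall x, x <= z -> K <= odds x.
Proof.
(* The maximum with [0] keeps the inverse positive when [K] is negative. *)
have K0 : 0 < (Num.max K 0 + 1)^-1 by rewrite invr_gt0 ltr_wpDl// le_max lexx orbT.
have [z zK] := Phi_inf _ K0; exists z => x /odds_le; apply: le_trans.
rewrite oddsE lerBrDr (@le_trans _ _ (Num.max K 0 + 1))//.
  by rewrite lerD2r le_max lexx.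
by rewrite -[leLHS]invrK lef_pV2 ?posrE ?Phi_gt0// ltW.
Qed.

Lemma w_bounds a b : exists2 m, 0 < m & forall x, a <= x <= b -> m <= w x <= m^-1.
Proof.
have [ab|ba] := leP a b; last first.
  by exists 1 => // x /andP[ax xb]; have := le_lt_trans (le_trans ax xb) ba; rewrite ltxx.
have cw : {within `[a, b], continuous w} by exact: continuous_subspaceT.
have [p _ wp] := EVT_min ab cw.
have [q _ wq] := EVT_max ab cw.
have wq0 : 0 < (w q)^-1 by rewrite invr_gt0.
exists (Num.min (w p) (w q)^-1); first by rewrite lt_min w_gt0.
move=> x xab; apply/andP; split.
  by rewrite ge_min wp.
rewrite (le_trans (wq x _))// -[leLHS]invrK lef_pV2 ?posrE ?lt_min ?w_gt0//.
by rewrite ge_min lexx orbT.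
Qed.

Lemma odds_le_g_infty : w x @[x --> -oo] --> +oo -> forall K, exists2 C, 0 < C &
  forall x, K <= g_infty w x \/ odds x <= C * g_infty w x.
Proof.
move=> /cvgryPge w_Ny K.
have [M [_ MK]] := w_Ny K.
pose a := M - 1.
have [m m0 wm] := w_bounds a 1.
have p0 : 0 < normal_peak 1 :> R by rewrite normal_peak_gt0.
(* [C1] serves on [[a, 1[], where [odds x <= odds a] and [m <= w x]; [C2] serves from [1] on, where
   Mills' upper bound meets [Phi 1 <= Phi x]. *)
pose C1 := odds a / m; pose C2 := normal_peak 1 / Phi 1 : R.
have C10 : 0 < C1 by rewrite divr_gt0 ?odds_gt0.
have C20 : 0 < C2 by rewrite divr_gt0 ?Phi_gt0.
exists (C1 + C2); first by rewrite addr_gt0.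
move=> x; rewrite /g_infty; case: (ltP x 1) => x1; last first.
  right; have x0 : 0 < x by lra.
  set g := _ / x; have g0 : 0 < g by rewrite divr_gt0 ?expR_gt0.
  apply: (@le_trans _ _ (C2 * g)); last by rewrite ler_pM2r// lerDr ltW.
  rewrite /odds PhibarE ler_pdivrMr ?Phi_gt0// (le_trans (mills_ub _ x0))//.
  rewrite phiE -mulrA -/g.
  have -> : C2 * g * Phi x = normal_peak 1 * g * (Phi x / Phi 1) by rewrite /C2; ring.
  rewrite ler_peMr//; first by rewrite ltW// mulr_gt0.
  by rewrite ler_pdivlMr ?Phi_gt0// mul1r ler_Phi.
have [xa|ax] := ltP x a.
  by left; apply: MK; rewrite (lt_trans xa)// /a ltrBlDr ltrDl.
right; have /andP[mw _] : m <= w x <= m^-1 by rewrite wm// ax ltW.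
apply: (@le_trans _ _ (C1 * w x)); last by rewrite ler_pM2r// lerDl ltW.
rewrite (le_trans (odds_le _ _ ax))// /C1 mulrAC ler_pdivlMr// ler_pM2l//.
exact: odds_gt0.
Qed.

Lemma g_infty_le_odds K : exists2 C, 0 < C &
  forall x, K <= odds x \/ g_infty w x <= C * odds x.
Proof.
have [z zK] := odds_large K.
have [m m0 wm] := w_bounds z 1.
have p0 : 0 < normal_peak 1 :> R by rewrite normal_peak_gt0.
(* [C1] serves between [z] and [1], where [w x <= m^-1] and [odds 1 <= odds x]; [C2] inverts the
   constant of Mills' lower bound. *)
pose C1 := (m * odds 1)^-1; pose C2 := (expR (- (3 / 2)) * normal_peak 1)^-1 : R.
have C10 : 0 < C1 by rewrite invr_gt0 mulr_gt0 ?odds_gt0.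
have C20 : 0 < C2 by rewrite invr_gt0 mulr_gt0 ?expR_gt0.
exists (C1 + C2); first by rewrite addr_gt0.
move=> x; have ox := odds_gt0 x; rewrite /g_infty; case: (ltP x 1) => x1; last first.
  right; have x0 : 0 < x by lra.
  apply: (@le_trans _ _ (C2 * odds x)); last by rewrite ler_pM2r// lerDr ltW.
  rewrite /C2 [leRHS]mulrC ler_pdivlMr ?mulr_gt0 ?expR_gt0//.
  apply: le_trans (_ : expR (- (3 / 2)) * (normal_pdf 0 1 x / x) <= _).
    by rewrite phiE le_eqVlt; apply/orP; left; apply/eqP; ring.
  rewrite (le_trans (mills_lb _ x1))//.
  by rewrite /odds PhibarE ler_pdivlMr ?Phi_gt0// ler_piMr ?Phi_ge0 ?Phi_le1.
have [xz|/ltW zx] := leP x z; first by left; exact: zK.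
right; have /andP[_ mw] : m <= w x <= m^-1 by rewrite wm// zx ltW.
apply: (@le_trans _ _ (C1 * odds x)); last by rewrite ler_pM2r// lerDl ltW.
rewrite (le_trans mw)// /C1 invfM -mulrA ler_peMr ?invr_ge0 ?(ltW m0)//.
by rewrite mulrC ler_pdivlMr ?odds_gt0// mul1r odds_le// ltW.
Qed.

End OddsVsG.

(** * Exchange of critical values with tails of order [1 / d] *)

Section CriticalValues.
Context {R : realType}.
Implicit Types (k c : nat -> R) (theta : triangular_array R).

Definition inverse_dim_tail k := exists2 A : R, 0 < A &
  exists B : R, \forall d \near \oo, A <= d%:R * Phi (- k d) <= B.

Lemma sum_odds_transfer k c theta : inverse_dim_tail k -> inverse_dim_tail c ->
  \sum_(i < d) odds (k d - `|tnth (theta d) i|) @[d --> \oo] --> +oo ->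
  \sum_(i < d) odds (c d - `|tnth (theta d) i|) @[d --> \oo] --> +oo.
Proof.
move=> [A A0 [B kAB]] [A' A'0 [B' cAB]].
apply: sum_dominated_pinfty => [d i|d i|K]; [exact/ltW/odds_gt0|exact/ltW/odds_gt0|].
(* [B / A'] bounds the ratio of the two tails; [odds_shift] also asks for [1 <= D]. *)
pose D := Num.max 1 (B / A').
have D1 : 1 <= D by rewrite le_max lexx.
exists (D ^+ 2); first by rewrite exprn_gt0// (lt_le_trans _ D1).
near=> d => i.
have /andP[Ak kB] : A <= d%:R * Phi (- k d) <= B by near: d.
have /andP[Ac cB] : A' <= d%:R * Phi (- c d) <= B' by near: d.
have B0 : 0 < B by rewrite (lt_le_trans A0)// (le_trans Ak).
have d0 : 0 < d%:R :> R by rewrite -(pmulr_lgt0 _ (Phi_gt0 (- k d))) (lt_le_trans A0).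
have kc : Phi (- k d) <= D * Phi (- c d).
  rewrite -(ler_pM2l d0) (le_trans kB)// mulrCA.
  apply: (@le_trans _ _ (D * A')); last by rewrite ler_pM2l// (lt_le_trans _ D1).
  by rewrite -ler_pdivrMr// le_max lexx orbT.
have [Kc|//] := odds_shift _ (k d) (c d) _ D1 (normr_ge0 (tnth (theta d) i)) kc; last by right.
(* Here a single summand is at least [d%:R / B - 1], which eventually exceeds [K]. *)
left; apply: le_trans Kc; rewrite lerBrDr.
apply: (@le_trans _ _ (d%:R / B)); last first.
  by rewrite ler_pdivrMr// mulrC ler_pdivlMr ?Phi_gt0.
rewrite ler_pdivlMr//; near: d; exact: nbhs_infty_ger.
Unshelve. all: by end_near. Qed.

End CriticalValues.

(** * Size, critical values and consistency of the test *)

Section Test.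
Context {disp : measure_display} {Omega : measurableType disp} {R : realType}.
Variables (P : probability Omega R) (eps : nat -> {RV P >-> R}).
Hypothesis eps_iid : iid_standard_normal eps.
Variables (alpha : R) (kappa : nat -> R).
Hypothesis alpha01 : 0 < alpha < 1.
Hypothesis kappa_size : tests_of_asymptotic_size eps alpha (sup_test kappa).

(* The test always rejects when [kappa d <= 0]. *)
Definition accept (d : nat) (theta : d.-tuple R) : R :=
  if 0 < kappa d then \prod_(i < d) coverage (kappa d) `|tnth theta i| else 0.

Lemma expectation_accept (d : nat) (theta : d.-tuple R) :
  'E_P[fun omega => sup_test kappa (vadd theta (noise eps d omega))]%E =
  (1 - accept d theta)%:E.
Proof.
rewrite /accept; case: ifPn => [k0|]; first exact: expectation_sup_test.
rewrite -leNgt subr0 => k0.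
rewrite [X in 'E_P[X]%E](_ : _ = cst 1) ?expectation_cst//.
apply/funext => omega; rewrite /sup_test indicE mem_set//=.
rewrite (le_trans k0)// /supnorm; elim/big_ind : _ => // x y x0 _.
by rewrite le_max x0.
Qed.

(** Used with [a = alpha] under the null hypothesis and with [a = 1] for consistency. *)
Lemma cvg_accept (theta : triangular_array R) (a : R) :
  'E_P[fun omega => sup_test kappa (vadd (theta d) (noise eps d omega))]%E @[d --> \oo]
    --> a%:E <->
  accept d (theta d) @[d --> \oo] --> 1 - a.
Proof.
under eq_cvg do rewrite expectation_accept.
split.
  move=> /fine_cvgP[_ ca].
  have -> : (fun d => accept d (theta d)) = (fun d => 1 - (1 - accept d (theta d))).
    by apply/funext => d; rewrite subKr.
  by apply: cvgB => //; exact: cvg_cst.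
move=> ca; apply/fine_cvgP; split; first exact: nearW.
rewrite -(subKr 1 a).
by apply: cvgB => //; exact: cvg_cst.
Qed.

Definition null (d : nat) : d.-tuple R := [tuple 0 | i < d].

Lemma cvg_accept_null : accept d (null d) @[d --> \oo] --> 1 - alpha.
Proof.
apply/(cvg_accept null); case: kappa_size => _; apply: cvg_trans.
apply: near_eq_cvg; apply: nearW => d; congr expectation.
apply/funext => omega; congr sup_test.
by apply: eq_from_tnth => i; rewrite !tnth_mktuple add0r.
Qed.

(** The limit [1 - alpha] lies strictly between the bounds; [kappa d] is positive because [accept]
    would otherwise be [0]. *)
Lemma near_accept_null : \forall d \near \oo,
  (0 < kappa d) /\ (1 - alpha) / 2 <= accept d (null d) <= 1 - alpha / 2.
Proof.
case/andP: alpha01 => a0 a1.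
have l1 : (1 - alpha) / 2 < 1 - alpha by lra.
have l2 : 1 - alpha < 1 - alpha / 2 by lra.
near=> d.
have lb : (1 - alpha) / 2 < accept d (null d).
  by near: d; exact: cvgr_gt cvg_accept_null _ l1.
have ub : accept d (null d) < 1 - alpha / 2.
  by near: d; exact: cvgr_lt cvg_accept_null _ l2.
split; last by rewrite !ltW.
by move: lb; rewrite /accept; case: ifP => // _; lra.
Unshelve. all: by end_near. Qed.

Lemma accept_nullE (d : nat) : 0 < kappa d ->
  accept d (null d) = (1 - 2 * Phi (- kappa d)) ^+ d.
Proof.
move=> k0; rewrite /accept k0 -coverage0.
under eq_bigr do rewrite tnth_mktuple normr0.
by rewrite prodr_const card_ord.
Qed.

(** With [q] the tail at [kappa d], [(1 - 2 * q) ^+ d] stays away from [0] and [1]: Bernoulli's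
    inequality bounds [d * q] below, and [1 - 2 * q <= expR (- (2 * q))] bounds it above. *)
Lemma critical_value_tail : inverse_dim_tail kappa.
Proof.
case/andP: alpha01 => a0 a1.
exists (alpha / 4); first by lra.
exists (- ln ((1 - alpha) / 2) / 2).
near=> d.
have [k0] : (0 < kappa d) /\ (1 - alpha) / 2 <= accept d (null d) <= 1 - alpha / 2.
  by near: d; exact: near_accept_null.
rewrite accept_nullE// => /andP[lb ub].
set q := Phi _ in lb ub *.
have q0 : 0 < q by exact: Phi_gt0.
have q2 : 0 < 1 - 2 * q by rewrite -coverage0 coverage_gt0.
have bernoulli n : 1 - n%:R * (2 * q) <= (1 - 2 * q) ^+ n.
  elim: n => [|n IH]; first by rewrite expr0 mul0r subr0.
  rewrite exprSr; apply: (@le_trans _ _ ((1 - n%:R * (2 * q)) * (1 - 2 * q))).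
    have : 0 <= n%:R * (2 * q) * (2 * q) by rewrite !mulr_ge0 ?(ltW q0).
    rewrite -natr1; lra.
  by rewrite ler_pM2r.
apply/andP; split.
  have := bernoulli d; lra.
have : (1 - alpha) / 2 <= expR (- (2 * q)) ^+ d.
  by rewrite (le_trans lb)// lerXn2r ?nnegrE ?expR_ge0 ?(ltW q2)// expR_ge1Dx.
rewrite -expRM_natl => lbe.
have l0 : 0 < (1 - alpha) / 2 by lra.
have : ln ((1 - alpha) / 2) <= ln (expR (d%:R * - (2 * q))).
  by rewrite ler_ln ?posrE ?expR_gt0.
rewrite expRK; lra.
Unshelve. all: by end_near. Qed.

Lemma consistency_sum_odds (theta : triangular_array R) :
  consistency_set eps (sup_test kappa) theta <->
  \sum_(i < d) odds (kappa d - `|tnth (theta d) i|) @[d --> \oo] --> +oo.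
Proof.
case/andP: alpha01 => a0 a1.
rewrite /consistency_set /mkset cvg_accept subrr.
split=> [acc0|Sy].
  apply/cvgryPge => K.
  (* A sum below [K] would keep the acceptance probability above this threshold, although it tends
     to [0]. *)
  have e0 : 0 < expR (- K) * ((1 - alpha) / 2) by rewrite mulr_gt0 ?expR_gt0//; lra.
  near=> d; rewrite leNgt; apply/negP => SK.
  have [k0 /andP[lb _]] : (0 < kappa d) /\
      (1 - alpha) / 2 <= accept d (null d) <= 1 - alpha / 2.
    by near: d; exact: near_accept_null.
  have : accept d (theta d) < expR (- K) * ((1 - alpha) / 2).
    by near: d; exact: cvgr_lt acc0 _ e0.
  apply/negP; rewrite -leNgt.
  apply: (@le_trans _ _ ((\prod_(i < d) Phi (kappa d - `|tnth (theta d) i|)) *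
      accept d (null d))).
    rewrite ler_pM ?expR_ge0//; first lra.
    by rewrite (le_trans _ (prod_Phi_ge _ _))// ler_expR lerN2 ltW.
  (* The null acceptance probability becomes a product over coordinates, so that [coverage_ge]
     applies factor by factor. *)
  rewrite accept_nullE// -coverage0 -[in X in _ ^+ X](card_ord d) -prodr_const.
  rewrite -big_split/= /accept k0 ler_prod// => i _.
  by rewrite mulr_ge0 ?Phi_ge0 ?coverage_ge// ltW// coverage_gt0.
apply/cvgr0Pnorm_le => e e0.
near=> d.
have [k0 _] : (0 < kappa d) /\
    (1 - alpha) / 2 <= accept d (null d) <= 1 - alpha / 2.
  by near: d; exact: near_accept_null.
(* This size of the sum makes the bound of [prod_Phi_le] at most [e]. *)
have Se : e^-1 <= \sum_(i < d) odds (kappa d - `|tnth (theta d) i|).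
  by near: d; exact: (cvgryPge _).1 Sy _.
have ei : 0 < e^-1 by rewrite invr_gt0.
rewrite /accept k0 ger0_norm; last first.
  by apply: prodr_ge0 => i _; rewrite ltW ?coverage_gt0.
apply: (@le_trans _ _ (\prod_(i < d) Phi (kappa d - `|tnth (theta d) i|))).
  by apply: ler_prod => i _; rewrite coverage_le ltW ?coverage_gt0.
rewrite (le_trans (prod_Phi_le _ _))// -[leRHS]invrK lef_pV2 ?posrE//; lra.
Unshelve. all: by end_near. Qed.

End Test.

(** * From [kappa] to [frak_c], and from [odds] to [g_infty] *)

Theorem theorem3p5 (disp : measure_display) (Omega : measurableType disp)
    (R : realType) (P : probability Omega R) (eps : nat -> {RV P >-> R})
    (eps_iid : iid_standard_normal eps)
    (w : R -> R) (w_gt0 : forall x, 0 < w x) (w_cont : continuous w)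
    (w_Ny : w x @[x --> -oo] --> +oo)
    (alpha : R) (alpha01 : 0 < alpha < 1)
    (kappa : nat -> R)
    (kappa_size : tests_of_asymptotic_size eps alpha (sup_test kappa))
    (theta : triangular_array R) :
  (consistency_set eps (sup_test kappa) theta <->
   \sum_(i < d) (Phibar (frak_c d - `|tnth (theta d) i|) /
                 Phi (frak_c d - `|tnth (theta d) i|)) @[d --> \oo] --> +oo) /\
  (\sum_(i < d) (Phibar (frak_c d - `|tnth (theta d) i|) /
                 Phi (frak_c d - `|tnth (theta d) i|)) @[d --> \oo] --> +oo <->
   \sum_(i < d) g_infty w (frak_c d - `|tnth (theta d) i|) @[d --> \oo] --> +oo).
Proof.
rewrite -[X in _ <-> X]/(\sum_(i < d) odds (frak_c d - `|tnth (theta d) i|)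
  @[d --> \oo] --> +oo).
have kt := critical_value_tail _ _ eps_iid _ _ alpha01 kappa_size.
have ct : inverse_dim_tail (@frak_c R) by exact: frak_c_tail.
split.
  rewrite (consistency_sum_odds _ _ eps_iid _ _ alpha01 kappa_size).
  by split; apply: sum_odds_transfer.
split; apply: sum_dominated_pinfty => [d i|d i|K]; try exact/ltW/odds_gt0;
  try exact/ltW/g_infty_gt0.
- have [C C0 HC] := odds_le_g_infty _ w_gt0 w_cont w_Ny K.
  by exists C => //; apply: nearW => d i; exact: HC.
- have [C C0 HC] := g_infty_le_odds _ w_gt0 w_cont K.
  by exists C => //; apply: nearW => d i; exact: HC.
Qed.
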